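(* Let $N<0$ and $\lambda_\sharp<\lambda_\flat$. Suppose all $a_j,b_j$, $\tau>0$ and $\alpha$ are real and $z>0$. Then $\overline{\phi(\bar s)}=\phi(s)$, and consequently $$K^{\rightarrow}(z),\,K^{\leftarrow}(z)\in\mathbb{R},\qquad K^{\downarrow}(z)=\overline{K^{\uparrow}(z)},\qquad \operatorname{Re}K^{\uparrow}(z)=\tfrac12\big(K^{\rightarrow}(z)+K^{\leftarrow}(z)\big).$$ Hence at most three real degrees of freedom survive among the four functions, namely $K^{\rightarrow}$, $K^{\leftarrow}$ and $\operatorname{Im}K^{\uparrow}$: these three real quantities determine all four values.
   Context: For $\tau>0$, $G(z;\tau)$ is the Barnes double gamma function: the entire function $G(z;\tau)=\frac{z}{\tau}e^{c_1 z/\tau+c_2 z^2/(2\tau^2)}\prod_{(k,l)\in\mathbb{Z}_{\ge0}^2\setminus\{(0,0)\}}\big(1+\frac{z}{k\tau+l}\big)e^{-\frac{z}{k\tau+l}+\frac{z^2}{2(k\tau+l)^2}}$, with real constants $c_1,c_2$ (depending on $\tau$) uniquely determined by $G(z+1;\tau)=\Gamma(z/\tau)G(z;\tau)$ and $G(z+\tau;\tau)=(2\pi)^{(\tau-1)/2}\tau^{1/2-z}\Gamma(z)G(z;\tau)$. Let $0\le m\le q$, $0\le n\le p$ be integers, $\mathbf a=(a_1,\dots,a_p)$, $\mathbf b=(b_1,\dots,b_q)$. Put $$\mathcal G(s)=\frac{\prod_{j=1}^{m}G(b_j-s;\tau)\prod_{j=1}^{n}G(1+\tau-a_j+s;\tau)}{\prod_{j=m+1}^{q}G(1+\tau-b_j+s;\tau)\prod_{j=n+1}^{p}G(a_j-s;\tau)},\quad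 \phi(s)=\mathcal G(s)e^{\pi\alpha s^2/\tau},\quad N=2(m+n)-p-q,$$ $\Lambda^+=\{a_j+l\tau+k: n<j\le p,\ l,k\in\mathbb{Z}_{\ge0}\}$, $\Lambda^-=\{b_j-l\tau-k: m<j\le q,\ l,k\in\mathbb{Z}_{\ge1}\}$, $\lambda_\sharp=\max_{m<j\le q}\operatorname{Re}b_j-\tau-1$ ($-\infty$ if $m=q$), $\lambda_\flat=\min_{n<j\le p}\operatorname{Re}a_j$ ($+\infty$ if $n=p$). For $z>0$, $z^{-s}=e^{-s\ln z}$ with $\ln z$ real. $L_{\theta^-,\theta^+}$ denotes a simple, piecewise smooth, proper curve in $\mathbb{C}\setminus(\Lambda^+\cup\Lambda^-)$ that outside some disc coincides with two straight rays of angles $\theta^-\in(-\pi,0)$, $\theta^+\in(0,\pi)$, is traversed from the $\theta^-$ end to the $\theta^+$ end, and has $\Lambda^+$ in the component of its complement containing the large positive reals and $\Lambda^-$ in the other. For $\varepsilon\in(0,\pi/4)$, $K^{\rightarrow},K^{\leftarrow},K^{\uparrow},K^{\downarrow}$ are $\frac{1}{2\pi i}\int_\gamma\phi(s)z^{-s}ds$ with $\gamma=L_{-\varepsilon,\varepsilon}$, $L_{-\pi+\varepsilon,\pi-\varepsilon}$, $L_{-\varepsilon,\pi-\varepsilon}$, $L_{-\pi+\varepsilon,\varepsilon}$ respectively (for $N<0$ absolutely convergent and independent of the choices). *)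

(* Defs.v *)
(* Stdlib reals with Coquelicot's complex numbers. *)
From Stdlib Require Export Reals ZArith List.
From Coquelicot Require Export Coquelicot.

Local Open Scope C_scope.

Definition Cexp (s : C) : C :=
  ((exp (Re s) * cos (Im s))%R, (exp (Re s) * sin (Im s))%R).

(* [x ^ s] for real [x > 0], with the real logarithm. *)
Definition Rcpow (x : R) (s : C) : C := Cexp (s * RtoC (ln x)).

(* Limit of a complex sequence, total like [Lim_seq]: it is only meaningful
   for convergent sequences. *)
Definition CLim_seq (u : nat -> C) : C :=
  (real (Lim_seq (fun n => Re (u n))), real (Lim_seq (fun n => Im (u n)))).

(* The product of [f j] over [m < j <= q]. *)
Definition Cprod (m q : nat) (f : nat -> C) : C :=
  fold_right (fun j acc => f j * acc) (RtoC 1) (seq (S m) (q - m)).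

Definition nonpos_int (s : C) : Prop := exists k : nat, s = - RtoC (INR k).

(* Euler's Gamma function by Gauss's limit
   [n! n^s / (s (s+1) ... (s+n))], valid off the non-positive integers. *)
Definition CGamma (s : C) : C :=
  CLim_seq (fun n =>
    RtoC (INR (fact n)) * Rcpow (INR n) s
    / fold_right (fun j acc => (s + RtoC (INR j)) * acc) (RtoC 1) (seq 0 (S n))).

Definition lattice_pt (tau : R) (k l : nat) : R := (INR k * tau + INR l)%R.

Definition barnes_factor (tau : R) (s : C) (k l : nat) : C :=
  match k, l with
  | O, O => RtoC 1
  | _, _ =>
      let w := RtoC (lattice_pt tau k l) in
      (RtoC 1 + s / w) * Cexp (- (s / w) + s ^ 2 / (RtoC 2 * w ^ 2))
  end.

(* The double product converges absolutely; it is computed here as the limit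
   over the squares [0 <= k, l < n]. *)
Definition barnes_prod (tau : R) (s : C) (n : nat) : C :=
  fold_right (fun k acc =>
    fold_right (fun l acc' => barnes_factor tau s k l * acc') (RtoC 1) (seq 0 n)
    * acc) (RtoC 1) (seq 0 n).

Definition barnes_G (tau c1 c2 : R) (s : C) : C :=
  s / RtoC tau
  * Cexp (RtoC c1 * s / RtoC tau + RtoC c2 * s ^ 2 / (RtoC 2 * RtoC tau ^ 2))
  * CLim_seq (barnes_prod tau s).

(* The two functional equations, which determine the real constants [c1, c2]. *)
Definition barnes_constants (tau c1 c2 : R) : Prop :=
  (forall s : C, ~ nonpos_int (s / RtoC tau) ->
     barnes_G tau c1 c2 (s + RtoC 1)
     = CGamma (s / RtoC tau) * barnes_G tau c1 c2 s) /\
  (forall s : C, ~ nonpos_int s ->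
     barnes_G tau c1 c2 (s + RtoC tau)
     = RtoC (Rpower (2 * PI) ((tau - 1) / 2)) * Rcpow tau (RtoC (1 / 2) - s)
       * CGamma s * barnes_G tau c1 c2 s).

(* The parameter vectors [a_1 .. a_p] and [b_1 .. b_q] are functions on [nat],
   of which only the values at [1 .. p] and [1 .. q] matter. *)
Definition calG (G : C -> C) (tau : R) (m n p q : nat) (a b : nat -> C) (s : C)
  : C :=
  Cprod 0 m (fun j => G (b j - s))
  * Cprod 0 n (fun j => G (RtoC 1 + RtoC tau - a j + s))
  / (Cprod m q (fun j => G (RtoC 1 + RtoC tau - b j + s))
     * Cprod n p (fun j => G (a j - s))).

Definition phi (G : C -> C) (tau : R) (alpha : C) (m n p q : nat)
  (a b : nat -> C) (s : C) : C :=
  calG G tau m n p q a b s * Cexp (RtoC PI * alpha * s ^ 2 / RtoC tau).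

Definition bigN (m n p q : nat) : Z :=
  (2 * (Z.of_nat m + Z.of_nat n) - Z.of_nat p - Z.of_nat q)%Z.

Definition Lambda_plus (tau : R) (n p : nat) (a : nat -> C) (s : C) : Prop :=
  exists j l k : nat, (n < j <= p)%nat /\
    s = a j + RtoC (INR l * tau) + RtoC (INR k).

Definition Lambda_minus (tau : R) (m q : nat) (b : nat -> C) (s : C) : Prop :=
  exists j l k : nat, (m < j <= q)%nat /\ (1 <= l)%nat /\ (1 <= k)%nat /\
    s = b j - RtoC (INR l * tau) - RtoC (INR k).

(* Maximum and minimum of finite sets, with the values [-oo] and [+oo] that
   [Lub_Rbar] and [Glb_Rbar] take on the empty set. *)
Definition lambda_sharp (tau : R) (m q : nat) (b : nat -> C) : Rbar :=
  Lub_Rbar (fun x => exists j : nat, (m < j <= q)%nat /\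
                       x = (Re (b j) - tau - 1)%R).

Definition lambda_flat (n p : nat) (a : nat -> C) : Rbar :=
  Glb_Rbar (fun x => exists j : nat, (n < j <= p)%nat /\ x = Re (a j)).

Definition connected_set (S : C -> Prop) : Prop :=
  forall U V : C -> Prop, open U -> open V ->
    (forall s, S s -> U s \/ V s) ->
    (forall s, S s -> ~ (U s /\ V s)) ->
    ~ ((exists s, S s /\ U s) /\ (exists s, S s /\ V s)).

Definition same_component (A : C -> Prop) (u v : C) : Prop :=
  exists S : C -> Prop, connected_set S /\ (forall s, S s -> A s) /\ S u /\ S v.

Definition on_curve (g : R -> C) (s : C) : Prop := exists t : R, g t = s.
Definition off_curve (g : R -> C) (s : C) : Prop := ~ on_curve g s.

Definition in_right_component (g : R -> C) (s : C) : Prop :=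
  exists X : R, forall x : R, (X <= x)%R -> same_component (off_curve g) s (RtoC x).

Definition curve_deriv (g : R -> C) (t : R) : C :=
  (Derive (fun u => Re (g u)) t, Derive (fun u => Im (g u)) t).

Definition curve_derivable (g : R -> C) (t : R) : Prop :=
  ex_derive (fun u => Re (g u)) t /\ ex_derive (fun u => Im (g u)) t.

(* Continuous, and continuously differentiable with non-zero velocity except
   at finitely many corners, where non-zero one-sided limits of the velocity
   exist. *)
Definition piecewise_smooth (g : R -> C) : Prop :=
  (forall t, continuous g t) /\
  exists corners : list R,
    (forall t, ~ In t corners ->
       curve_derivable g t /\ continuous (curve_deriv g) t /\
       curve_deriv g t <> RtoC 0) /\
    (forall t, In t corners ->
       exists vl vr : C, vl <> RtoC 0 /\ vr <> RtoC 0 /\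
         filterlim (curve_deriv g) (at_left t) (locally vl) /\
         filterlim (curve_deriv g) (at_right t) (locally vr)).

Definition on_ray (w : C) (theta : R) (s : C) : Prop :=
  exists r : R, (0 <= r)%R /\ s = w + RtoC r * Cexp (Ci * RtoC theta).

(* [g] parametrizes, over the whole real line, a curve [L_{thm,thp}]
   separating [Lp] (on the right) from [Lm]. *)
Record is_contour (thm thp : R) (Lp Lm : C -> Prop) (g : R -> C) : Prop := {
  contour_simple : forall t u : R, g t = g u -> t = u;
  contour_smooth : piecewise_smooth g;
  contour_proper :
    filterlim (fun t => Cmod (g t)) (Rbar_locally m_infty) (Rbar_locally p_infty) /\
    filterlim (fun t => Cmod (g t)) (Rbar_locally p_infty) (Rbar_locally p_infty);
  contour_rays : exists (wm wp : C) (rho : R),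
    (forall s : C, (rho < Cmod s)%R ->
       (on_curve g s <-> on_ray wm thm s \/ on_ray wp thp s)) /\
    (exists T : R,
       (forall t, (t < - T)%R -> on_ray wm thm (g t)) /\
       (forall t, (T < t)%R -> on_ray wp thp (g t)));
  contour_avoids : forall s, Lp s \/ Lm s -> off_curve g s;
  contour_right : forall s, Lp s -> in_right_component g s;
  contour_left : forall s, Lm s -> ~ in_right_component g s
}.

Definition is_abs_contour_integral (f : C -> C) (g : R -> C) (v : C) : Prop :=
  ex_RInt_gen (fun t => Cmod (f (g t) * curve_deriv g t))
    (Rbar_locally m_infty) (Rbar_locally p_infty) /\
  is_RInt_gen (V := C_R_NormedModule) (fun t => f (g t) * curve_deriv g t)
    (Rbar_locally m_infty) (Rbar_locally p_infty) v.

(* [v] is the value at [z] of the function defined by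
   [1 / (2 pi i) * \int_L f(s) z^{-s} ds], [L = L_{thm eps, thp eps}]: the
   common value of these absolutely convergent integrals for all [eps] in
   [(0, pi/4)] and all admissible [L]. *)
Definition is_K (f : C -> C) (Lp Lm : C -> Prop) (thm thp : R -> R)
  (z : R) (v : C) : Prop :=
  let admissible eps g :=
    (0 < eps < PI / 4)%R /\ is_contour (thm eps) (thp eps) Lp Lm g in
  (exists eps g, admissible eps g) /\
  (forall eps g, admissible eps g ->
     exists I : C,
       is_abs_contour_integral (fun s => f s * Rcpow z (- s)) g I /\
       v = RtoC 1 / (RtoC 2 * RtoC PI * Ci) * I).

Definition is_K_right f Lp Lm :=
  is_K f Lp Lm (fun eps => (- eps)%R) (fun eps => eps).
Definition is_K_left f Lp Lm :=
  is_K f Lp Lm (fun eps => (- PI + eps)%R) (fun eps => (PI - eps)%R).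
Definition is_K_up f Lp Lm :=
  is_K f Lp Lm (fun eps => (- eps)%R) (fun eps => (PI - eps)%R).
Definition is_K_down f Lp Lm :=
  is_K f Lp Lm (fun eps => (- PI + eps)%R) (fun eps => eps).

(* Main.v *)
Require Import Defs.
From Stdlib Require Import Lra Lia ClassicalEpsilon.
Local Open Scope C_scope.

(** All data being real, every operation that builds [phi] out of [s] commutes
    with complex conjugation, so the integrand [phi(s) z^(-s)] does too
    ([phi_conj_symmetric], [Mellin_conj_symmetric]).

    The four functions are compared on very special contours.  The real poles
    of the two families are separated by a real point [c] ([pole_separation]),
    and with a common angle [eps] each of the four contours may be taken to be
    a pair of straight rays issuing from [c] ([is_contour_kinked]).  Writing
    [R1], [R2], [R3], [R4] for the integrals along the outward rays of angles
    [eps], [PI - eps], [- PI + eps], [- eps], the values of [K] are, up to the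
    factor [1 / (2 PI i)],

      right = R1 - R4,  left = R2 - R3,  up = R2 - R4,  down = R1 - R3,

    whence right + left = up + down ([line_integral_exchange]).  Conjugation
    maps the right and the left contours to themselves and the up contour to
    the down one, reversing the orientation; the sign so produced is absorbed
    by [Cconj (1 / (2 PI i)) = - 1 / (2 PI i)].  Hence right and left are real
    and down is the conjugate of up ([is_line_integral_reflect],
    [conj_of_reflected_integral]), and the rest is algebra
    ([four_values_of_symmetry]).

    The rays are never horizontal, so all these contours are graphs
    [x = c + slope * y] over the imaginary axis, with one slope below and one
    above the real line.  Parametrized by [y], they make the identity between
    ray integrals a pointwise identity between integrands, conjugation becomes
    the substitution of [- y] for [y], and the two sides of the contour are the
    open sets where [x] exceeds, or is less than, a continuous function of
    [y]. *)

(** * Conjugation symmetry of the integrand *)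

Definition conj_symmetric (f : C -> C) : Prop :=
  forall s, Cconj (f (Cconj s)) = f s.

Lemma Cconj_RtoC (x : R) : Cconj (RtoC x) = RtoC x.
Proof. unfold Cconj, RtoC; simpl; f_equal; ring. Qed.

Lemma Cconj_real (s : C) : Im s = 0%R -> Cconj s = s.
Proof. destruct s as [x y]; simpl; intros ->; apply Cconj_RtoC. Qed.

(** With [/ 0 = 0] this holds at [0], hence the symmetry of [phi] at its
    poles. *)
Lemma Cinv_conj_total (s : C) : Cconj (/ s) = / Cconj s.
Proof.
  destruct s as [x y]; unfold Cconj, Cinv; simpl.
  replace (- y * (- y * 1))%R with (y * (y * 1))%R by ring.
  f_equal; unfold Rdiv; ring.
Qed.

Lemma Cdiv_conj_total (s t : C) : Cconj (s / t) = Cconj s / Cconj t.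
Proof. unfold Cdiv; now rewrite Cmult_conj, Cinv_conj_total. Qed.

Lemma Cexp_conj (s : C) : Cconj (Cexp s) = Cexp (Cconj s).
Proof.
  destruct s as [x y]; unfold Cexp, Cconj; simpl.
  rewrite cos_neg, sin_neg; f_equal; ring.
Qed.

Lemma Rcpow_conj (x : R) (s : C) : Cconj (Rcpow x s) = Rcpow x (Cconj s).
Proof. unfold Rcpow; now rewrite Cexp_conj, Cmult_conj, Cconj_RtoC. Qed.

(** Valid for every sequence: [Lim_seq] is the half-sum of a limit superior and
    a limit inferior, hence odd, and [real] is odd on [Rbar]. *)
Lemma CLim_seq_conj (u : nat -> C) :
  Cconj (CLim_seq u) = CLim_seq (fun n => Cconj (u n)).
Proof.
  unfold CLim_seq, Cconj; simpl; f_equal.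
  change (fun n => - snd (u n))%R with (fun n => - Im (u n))%R.
  rewrite Lim_seq_opp.
  destruct (Lim_seq (fun n => Im (u n))); simpl; ring.
Qed.

Lemma CLim_seq_ext (u v : nat -> C) :
  (forall n, u n = v n) -> CLim_seq u = CLim_seq v.
Proof.
  intros H; unfold CLim_seq.
  f_equal; f_equal; apply Lim_seq_ext; intros n; now rewrite H.
Qed.

Lemma fold_prod_conj {T : Type} (g h : T -> C) (l : list T) :
  (forall x, In x l -> Cconj (g x) = h x) ->
  Cconj (fold_right (fun x acc => g x * acc) (RtoC 1) l)
  = fold_right (fun x acc => h x * acc) (RtoC 1) l.
Proof.
  induction l as [|x l IH]; simpl; intros H.
  - apply Cconj_RtoC.
  - rewrite Cmult_conj, H, IH; auto.
Qed.

Lemma Cprod_conj (m q : nat) (g h : nat -> C) :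
  (forall j, (m < j <= q)%nat -> Cconj (g j) = h j) ->
  Cconj (Cprod m q g) = Cprod m q h.
Proof.
  intros H; apply fold_prod_conj; intros j Hj.
  apply in_seq in Hj; apply H; lia.
Qed.

Lemma barnes_factor_conj (tau : R) (s : C) (k l : nat) :
  Cconj (barnes_factor tau s k l) = barnes_factor tau (Cconj s) k l.
Proof.
  assert (E : forall w : R,
    Cconj ((RtoC 1 + s / RtoC w)
           * Cexp (- (s / RtoC w) + s ^ 2 / (RtoC 2 * RtoC w ^ 2)))
    = (RtoC 1 + Cconj s / RtoC w)
      * Cexp (- (Cconj s / RtoC w) + Cconj s ^ 2 / (RtoC 2 * RtoC w ^ 2))).
  { intros w.
    rewrite Cmult_conj, Cplus_conj, Cexp_conj, Cplus_conj, Copp_conj,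
      !Cdiv_conj_total, Cmult_conj, !Cpow_conj, !Cconj_RtoC.
    reflexivity. }
  destruct k, l; simpl barnes_factor; try apply E.
  apply Cconj_RtoC.
Qed.

Lemma barnes_G_conj (tau c1 c2 : R) (s : C) :
  Cconj (barnes_G tau c1 c2 s) = barnes_G tau c1 c2 (Cconj s).
Proof.
  unfold barnes_G.
  rewrite !Cmult_conj, Cexp_conj, Cplus_conj, !Cdiv_conj_total, !Cmult_conj,
    !Cpow_conj, !Cconj_RtoC, CLim_seq_conj.
  f_equal; apply CLim_seq_ext; intros n; unfold barnes_prod.
  apply (fold_prod_conj (fun k => fold_right _ _ _)); intros k _.
  apply fold_prod_conj; intros l _; apply barnes_factor_conj.
Qed.

Lemma phi_conj_symmetric (tau c1 c2 : R) (alpha : C) (m n p q : nat)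
    (a b : nat -> C) :
  (m <= q)%nat -> (n <= p)%nat ->
  (forall j, (1 <= j <= p)%nat -> Im (a j) = 0%R) ->
  (forall j, (1 <= j <= q)%nat -> Im (b j) = 0%R) ->
  Im alpha = 0%R ->
  conj_symmetric (phi (barnes_G tau c1 c2) tau alpha m n p q a b).
Proof.
  intros Hm Hn Ha Hb Hal s; unfold phi, calG.
  rewrite Cmult_conj, Cdiv_conj_total, !Cmult_conj, Cexp_conj,
    Cdiv_conj_total, !Cmult_conj, Cpow_conj, Cconj_conj, (Cconj_real alpha),
    !Cconj_RtoC by assumption.
  f_equal; f_equal; f_equal; try f_equal; apply Cprod_conj; intros j Hj;
    rewrite barnes_G_conj; f_equal;
    rewrite ?Cplus_conj, ?Cminus_conj, ?Cplus_conj, ?Cconj_RtoC, Cconj_conj,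
      Cconj_real; auto; (apply Ha || apply Hb); lia.
Qed.

Lemma Mellin_conj_symmetric (f : C -> C) (z : R) :
  conj_symmetric f -> conj_symmetric (fun s => f s * Rcpow z (- s)).
Proof.
  intros Hf s.
  now rewrite Cmult_conj, Hf, Rcpow_conj, Copp_conj, Cconj_conj.
Qed.

(** * Improper integrals over the real line *)

(** The contours have a corner at parameter [0], where the total derivative in
    the integrand has no prescribed value; integrands are therefore compared
    off that single parameter. *)
Lemma is_RInt_gen_ext_off_zero (f g : R -> C) (Fa Fb : (R -> Prop) -> Prop) (l : C)
    {FFa : Filter Fa} {FFb : Filter Fb} :
  (forall t, t <> 0%R -> f t = g t) ->
  is_RInt_gen (V := C_R_NormedModule) f Fa Fb l ->
  is_RInt_gen (V := C_R_NormedModule) g Fa Fb l.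
Proof.
  intros Hfg Hf P HP.
  specialize (Hf P HP); unfold filtermapi in *.
  revert Hf; apply filter_imp; intros [x y]; simpl; intros [v [Hv HPv]].
  exists v; split; [|exact HPv].
  set (d := fun t => minus (G := C_R_NormedModule) (g t) (f t)).
  assert (Hd0 : forall t, t <> 0%R -> d t = zero).
  { intros t Ht; unfold d; rewrite Hfg by exact Ht.
    apply (minus_eq_zero (G := C_R_NormedModule)). }
  assert (Hhalf : forall w, is_RInt (V := C_R_NormedModule) d 0 w zero).
  { intros w.
    apply (is_RInt_ext (V := C_R_NormedModule) (fun _ => zero)).
    - intros t Ht; symmetry; apply Hd0; intros ->.
      unfold Rmin, Rmax in Ht; destruct (Rle_dec 0 w); lra.
    - pose proof (is_RInt_const (V := C_R_NormedModule) 0 w zero) as Hc.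
      now rewrite (scal_zero_r (V := C_R_NormedModule)) in Hc. }
  (* Chasles through [0] works whether or not [0] lies between [x] and [y]. *)
  assert (Hd : is_RInt (V := C_R_NormedModule) d x y zero).
  { pose proof (is_RInt_Chasles (V := C_R_NormedModule) d x 0 y _ _
      (is_RInt_swap (V := C_R_NormedModule) _ _ _ _ (Hhalf x)) (Hhalf y)) as Hc.
    now rewrite (plus_opp_l (G := C_R_NormedModule)) in Hc. }
  apply (is_RInt_ext (V := C_R_NormedModule)
           (fun t => plus (G := C_R_NormedModule) (f t) (d t))).
  - intros t _; unfold d, minus.
    rewrite (plus_comm (G := C_R_NormedModule) (g t)).
    rewrite (plus_assoc (G := C_R_NormedModule)).
    rewrite (plus_opp_r (G := C_R_NormedModule)).
    apply (plus_zero_l (G := C_R_NormedModule)).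
  - pose proof (is_RInt_plus (V := C_R_NormedModule) _ _ _ _ _ _ Hv Hd) as Hc.
    now rewrite (plus_zero_r (G := C_R_NormedModule)) in Hc.
Qed.

Lemma is_RInt_conj (f : R -> C) (x y : R) (l : C) :
  is_RInt (V := C_R_NormedModule) f x y l ->
  is_RInt (V := C_R_NormedModule) (fun t => Cconj (f t)) x y (Cconj l).
Proof.
  intros H.
  apply (is_RInt_fct_extend_pair (U := R_NormedModule) (V := R_NormedModule)).
  - apply (is_RInt_fct_extend_fst (U := R_NormedModule) (V := R_NormedModule) f),
      H.
  - apply (is_RInt_opp (V := R_NormedModule) (fun t => snd (f t))).
    apply (is_RInt_fct_extend_snd (U := R_NormedModule) (V := R_NormedModule) f),
      H.
Qed.

Lemma is_RInt_reflect (f : R -> C) (x y : R) (l : C) :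
  is_RInt (V := C_R_NormedModule) f (- y) (- x) l ->
  is_RInt (V := C_R_NormedModule) (fun t => f (- t)%R) x y l.
Proof.
  intros H.
  apply (is_RInt_comp_opp (V := C_R_NormedModule)) in H.
  apply (is_RInt_swap (V := C_R_NormedModule)) in H.
  apply (is_RInt_opp (V := C_R_NormedModule)) in H.
  rewrite (opp_opp (G := C_R_NormedModule)) in H.
  revert H; apply (is_RInt_ext (V := C_R_NormedModule)); intros t _.
  apply (opp_opp (G := C_R_NormedModule)).
Qed.

Lemma filterlim_Cconj (l : C) :
  filterlim Cconj (locally l) (locally (Cconj l)).
Proof.
  apply filterlim_locally; intros eps.
  exists eps; intros s [H1 H2]; split; [exact H1|].
  change (Rabs (- snd s - - snd l) < eps)%R.
  replace (- snd s - - snd l)%R with (- (snd s - snd l))%R by ring.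
  rewrite Rabs_Ropp; exact H2.
Qed.

Lemma is_RInt_gen_conj_reflect (f : R -> C) (l : C) :
  is_RInt_gen (V := C_R_NormedModule) f
    (Rbar_locally m_infty) (Rbar_locally p_infty) l ->
  is_RInt_gen (V := C_R_NormedModule) (fun t => Cconj (f (- t)%R))
    (Rbar_locally m_infty) (Rbar_locally p_infty) (Cconj l).
Proof.
  intros H P HP.
  specialize (H _ (filterlim_Cconj l P HP)).
  destruct H as [Q1 Q2 [M1 H1] [M2 H2] H].
  exists (fun x => Q2 (- x)%R) (fun y => Q1 (- y)%R).
  - exists (- M2)%R; intros x Hx; apply H2; lra.
  - exists (- M1)%R; intros x Hx; apply H1; lra.
  - intros x y Hx Hy; simpl.
    destruct (H _ _ Hy Hx) as [v [Hv HPv]]; simpl in Hv.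
    exists (Cconj v); split; [|exact HPv].
    apply (is_RInt_conj (fun t => f (- t)%R)), is_RInt_reflect, Hv.
Qed.

Lemma is_RInt_gen_unique_line (f : R -> C) (l1 l2 : C) :
  is_RInt_gen (V := C_R_NormedModule) f
    (Rbar_locally m_infty) (Rbar_locally p_infty) l1 ->
  is_RInt_gen (V := C_R_NormedModule) f
    (Rbar_locally m_infty) (Rbar_locally p_infty) l2 ->
  l1 = l2.
Proof.
  intros H1 H2.
  transitivity (RInt_gen (V := C_R_CompleteNormedModule) f
    (Rbar_locally m_infty) (Rbar_locally p_infty)); [symmetry|];
    apply (is_RInt_gen_unique (V := C_R_CompleteNormedModule)); assumption.
Qed.

(** * Contours made of two rays from a real point *)

(** The continuous function with slope [A] on the negative and [B] on the
    positive half-line; the formula by [Rabs] avoids a case distinction in the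
    proof of continuity. *)
Definition kink (c A B t : R) : R := (c + (A + B) / 2 * t + (B - A) / 2 * Rabs t)%R.

Definition kinked (c A B t : R) : C := (kink c A B t, t).

Lemma kink_pos (c A B t : R) : (0 <= t)%R -> kink c A B t = (c + B * t)%R.
Proof. intros H; unfold kink; rewrite Rabs_pos_eq by exact H; field. Qed.

Lemma kink_neg (c A B t : R) : (t <= 0)%R -> kink c A B t = (c + A * t)%R.
Proof. intros H; unfold kink; rewrite Rabs_left1 by exact H; field. Qed.

Lemma continuous_kink (c A B t : R) : continuous (kink c A B) t.
Proof.
  unfold kink.
  apply (continuous_plus (fun t => c + (A + B) / 2 * t)%R
                         (fun t => (B - A) / 2 * Rabs t)%R).
  - apply (continuous_plus (fun _ => c) (fun t => (A + B) / 2 * t)%R);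
      [apply continuous_const|].
    apply (continuous_mult (fun _ => (A + B) / 2)%R (fun t => t));
      [apply continuous_const|apply continuous_id].
  - apply (continuous_mult (fun _ => (B - A) / 2)%R Rabs);
      [apply continuous_const|apply continuous_Rabs].
Qed.

Lemma continuous_kinked (c A B t : R) : continuous (kinked c A B) t.
Proof.
  apply filterlim_locally; intros eps.
  pose proof (proj1 (filterlim_locally _ _) (continuous_kink c A B t) eps) as H.
  pose proof (locally_ball t eps) as H'.
  generalize (filter_and _ _ H H'); apply filter_imp; intros u [H1 H2].
  split; assumption.
Qed.

Lemma locally_pos (t : R) : (0 < t)%R -> locally t (fun u => (0 < u)%R).
Proof. intros H; exact (open_gt 0 t H). Qed.

Lemma locally_neg (t : R) : (t < 0)%R -> locally t (fun u => (u < 0)%R).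
Proof. intros H; exact (open_lt 0 t H). Qed.

Lemma is_derive_line (c A t : R) : is_derive (fun u => c + A * u)%R t A.
Proof. auto_derive; [exact I|ring]. Qed.

Lemma is_derive_kink_pos (c A B t : R) :
  (0 < t)%R -> is_derive (kink c A B) t B.
Proof.
  intros H; apply (is_derive_ext_loc (fun u => c + B * u)%R).
  - generalize (locally_pos t H); apply filter_imp; intros u Hu.
    symmetry; apply kink_pos; lra.
  - apply is_derive_line.
Qed.

Lemma is_derive_kink_neg (c A B t : R) :
  (t < 0)%R -> is_derive (kink c A B) t A.
Proof.
  intros H; apply (is_derive_ext_loc (fun u => c + A * u)%R).
  - generalize (locally_neg t H); apply filter_imp; intros u Hu.
    symmetry; apply kink_neg; lra.
  - apply is_derive_line.
Qed.

Lemma is_derive_kink (c A B t : R) :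
  t <> 0%R -> is_derive (kink c A B) t (if Rlt_dec 0 t then B else A).
Proof.
  intros Ht; destruct (Rlt_dec 0 t).
  - now apply is_derive_kink_pos.
  - apply is_derive_kink_neg; lra.
Qed.

Lemma curve_deriv_kinked (c A B t : R) :
  t <> 0%R -> curve_deriv (kinked c A B) t = (if Rlt_dec 0 t then B else A, 1%R).
Proof.
  intros Ht; unfold curve_deriv; simpl; f_equal.
  - apply is_derive_unique, is_derive_kink, Ht.
  - apply Derive_id.
Qed.

Lemma curve_deriv_kinked_pos (c A B t : R) :
  (0 < t)%R -> curve_deriv (kinked c A B) t = (B, 1%R).
Proof.
  intros Ht; rewrite curve_deriv_kinked by lra.
  destruct (Rlt_dec 0 t); [reflexivity|lra].
Qed.

Lemma curve_deriv_kinked_neg (c A B t : R) :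
  (t < 0)%R -> curve_deriv (kinked c A B) t = (A, 1%R).
Proof.
  intros Ht; rewrite curve_deriv_kinked by lra.
  destruct (Rlt_dec 0 t); [lra|reflexivity].
Qed.

Lemma slope_neq_0 (A : R) : (A, 1%R) <> RtoC 0.
Proof. intros H; injection H; lra. Qed.

Lemma filterlim_locally_const (F : (R -> Prop) -> Prop) {FF : Filter F}
    (g : R -> C) (v : C) :
  F (fun t => g t = v) -> filterlim g F (locally v).
Proof.
  intros H; apply (filterlim_ext_loc (fun _ => v)).
  - revert H; apply filter_imp; intros t Ht; now symmetry.
  - apply filterlim_const.
Qed.

Lemma piecewise_smooth_kinked (c A B : R) : piecewise_smooth (kinked c A B).
Proof.
  split; [apply continuous_kinked|].
  exists (0%R :: nil); split.
  - intros t Ht.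
    assert (Ht0 : t <> 0%R) by (intros ->; apply Ht; now left).
    split; [|split].
    + split; simpl.
      * eexists; apply is_derive_kink, Ht0.
      * apply ex_derive_id.
    + unfold continuous; rewrite curve_deriv_kinked by exact Ht0.
      apply filterlim_locally_const; [apply locally_filter|].
      destruct (Rlt_dec 0 t) as [H|H].
      * generalize (locally_pos t H); apply filter_imp, curve_deriv_kinked_pos.
      * assert (H' : (t < 0)%R) by lra.
        generalize (locally_neg t H'); apply filter_imp, curve_deriv_kinked_neg.
    + rewrite curve_deriv_kinked by exact Ht0; apply slope_neq_0.
  - intros t [<-|[]]; exists (A, 1%R), (B, 1%R).
    repeat split; try apply slope_neq_0.
    + apply filterlim_locally_const; [apply at_left_proper_filter|].
      exists (mkposreal 1 Rlt_0_1); intros u _; apply curve_deriv_kinked_neg.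
    + apply filterlim_locally_const; [apply at_right_proper_filter|].
      exists (mkposreal 1 Rlt_0_1); intros u _; apply curve_deriv_kinked_pos.
Qed.

Lemma Cmod_ge_abs_im (s : C) : (Rabs (Im s) <= Cmod s)%R.
Proof. eapply Rle_trans; [apply Rmax_r|apply Rmax_Cmod]. Qed.

Lemma kinked_proper (c A B : R) (x : Rbar) :
  x = m_infty \/ x = p_infty ->
  filterlim (fun t => Cmod (kinked c A B t)) (Rbar_locally x)
    (Rbar_locally p_infty).
Proof.
  intros Hx; apply (filterlim_ge_p_infty Rabs).
  - apply filter_forall; intros t; apply (Cmod_ge_abs_im (kinked c A B t)).
  - destruct Hx as [-> | ->]; intros P [M HM].
    + exists (- Rabs M)%R; intros t Ht; apply HM.
      pose proof (Rle_abs M); pose proof (Rle_abs (- t)).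
      rewrite Rabs_Ropp in *; lra.
    + exists (Rabs M)%R; intros t Ht; apply HM.
      pose proof (Rle_abs M); pose proof (Rle_abs t); lra.
Qed.

Lemma ray_point (c theta r : R) :
  RtoC c + RtoC r * Cexp (Ci * RtoC theta) = (c + r * cos theta, r * sin theta)%R.
Proof.
  unfold Cexp; simpl.
  replace (0 * theta - 1 * 0)%R with 0%R by ring.
  replace (0 * 0 + 1 * theta)%R with theta by ring.
  rewrite exp_0; unfold Cplus, Cmult, RtoC; simpl; f_equal; ring.
Qed.

(** The slope, as a graph over the imaginary axis, of the ray of angle
    [theta]. *)
Definition cot (theta : R) : R := (cos theta / sin theta)%R.

Lemma cot_sin (theta : R) : sin theta <> 0%R -> (cot theta * sin theta)%R = cos theta.
Proof. intros H; unfold cot; field; exact H. Qed.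

Lemma on_ray_up (c theta : R) (s : C) :
  (0 < sin theta)%R ->
  (on_ray (RtoC c) theta s <->
   (0 <= Im s)%R /\ Re s = (c + cot theta * Im s)%R).
Proof.
  intros Hs; destruct s as [x y]; unfold on_ray; simpl; split.
  - intros [r [Hr E]]; rewrite ray_point in E; injection E as -> ->; split.
    + apply Rmult_le_pos; lra.
    + rewrite <- (cot_sin theta) at 1 by lra; ring.
  - intros [Hy ->]; exists (y / sin theta)%R; split.
    + apply Rmult_le_pos; [exact Hy|].
      apply Rlt_le, Rinv_0_lt_compat, Hs.
    + rewrite ray_point; unfold cot; f_equal; field; lra.
Qed.

Lemma on_ray_down (c theta : R) (s : C) :
  (sin theta < 0)%R ->
  (on_ray (RtoC c) theta s <->
   (Im s <= 0)%R /\ Re s = (c + cot theta * Im s)%R).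
Proof.
  intros Hs; destruct s as [x y]; unfold on_ray; simpl; split.
  - intros [r [Hr E]]; rewrite ray_point in E; injection E as -> ->; split.
    + nra.
    + rewrite <- (cot_sin theta) at 1 by lra; ring.
  - intros [Hy ->]; exists (y / sin theta)%R; split.
    + replace (y / sin theta)%R with (- y * / - sin theta)%R by (field; lra).
      apply Rmult_le_pos; [lra|].
      apply Rlt_le, Rinv_0_lt_compat; lra.
    + rewrite ray_point; unfold cot; f_equal; field; lra.
Qed.

Lemma on_curve_kinked (c A B : R) (s : C) :
  on_curve (kinked c A B) s <-> Re s = kink c A B (Im s).
Proof.
  destruct s as [x y]; unfold on_curve, kinked; simpl; split.
  - intros [t E]; now injection E as <- ->.
  - intros ->; now exists y.
Qed.

(** A separation of the range by two open sets would give a continuous function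
    [chi] with values [0] and [1] only, against the intermediate value
    theorem. *)
Lemma connected_range (g : R -> C) :
  (forall t, continuous g t) -> connected_set (on_curve g).
Proof.
  intros Hg U V HU HV Hcov Hdisj [[u [[t1 <-] Hu]] [v [[t2 <-] Hv]]].
  set (chi := fun t : R =>
    if excluded_middle_informative (U (g t)) then 0%R else 1%R).
  assert (Hchi : continuity chi).
  { intros t; apply continuity_pt_filterlim.
    destruct (Hcov (g t) (ex_intro _ t eq_refl)) as [H|H].
    - apply (filterlim_ext_loc (fun _ => chi t)); [|apply filterlim_const].
      pose proof (Hg t _ (HU _ H)) as Hn; unfold filtermap in Hn; revert Hn.
      apply filter_imp; intros w Hw.
      unfold chi; do 2 destruct excluded_middle_informative; tauto.
    - apply (filterlim_ext_loc (fun _ => chi t)); [|apply filterlim_const].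
      pose proof (Hg t _ (HV _ H)) as Hn; unfold filtermap in Hn; revert Hn.
      apply filter_imp; intros w Hw.
      pose proof (Hdisj (g w) (ex_intro _ w eq_refl)).
      pose proof (Hdisj (g t) (ex_intro _ t eq_refl)).
      unfold chi; do 2 destruct excluded_middle_informative; tauto. }
  pose proof (Hdisj _ (ex_intro _ t2 eq_refl)) as Hd.
  assert (E1 : chi t1 = 0%R)
    by (unfold chi; destruct excluded_middle_informative; tauto).
  assert (E2 : chi t2 = 1%R)
    by (unfold chi; destruct excluded_middle_informative; tauto).
  destruct (IVT_gen chi t1 t2 (1 / 2) Hchi) as [t [_ Ht]].
  - rewrite E1, E2, Rmin_left, Rmax_right by lra; lra.
  - unfold chi in Ht; destruct excluded_middle_informative; lra.
Qed.

(** The real half-line beyond [c] misses the contour and is connected, being the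
    range of [c + exp]. *)
Lemma in_right_component_of_gt (c A B x : R) :
  (c < x)%R -> in_right_component (kinked c A B) (RtoC x).
Proof.
  intros Hx; exists x; intros y Hy.
  set (g := fun t : R => RtoC (c + exp t)).
  assert (Hline : forall w, (c < w)%R -> on_curve g (RtoC w)).
  { intros w Hw; exists (ln (w - c)); unfold g.
    rewrite exp_ln by lra; f_equal; ring. }
  exists (on_curve g); split; [|split; [|split]].
  - apply connected_range; intros t.
    apply (continuous_comp (fun t => c + exp t)%R RtoC).
    + apply (continuous_plus (fun _ => c) exp); [apply continuous_const|].
      apply continuous_exp.
    + apply filterlim_locally; intros eps; exists eps; intros w Hw.
      split; [exact Hw|apply ball_center].
  - intros s [t <-] H; apply on_curve_kinked in H; simpl in H.
    rewrite kink_pos in H by lra.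
    pose proof (exp_pos t); lra.
  - apply Hline, Hx.
  - apply Hline; lra.
Qed.

Lemma open_kink_side (c A B : R) (D : R -> Prop) :
  open D -> open (fun s : C => D (Re s - kink c A B (Im s))%R).
Proof.
  intros HD.
  apply (open_comp (fun s : C => Re s - kink c A B (Im s))%R D); [|exact HD].
  intros s _.
  apply (continuous_minus (U := C_UniformSpace) (V := R_NormedModule)
           (fun s : C => Re s) (fun s => kink c A B (Im s))).
  - apply continuous_fst.
  - apply (continuous_comp (fun s : C => Im s) (kink c A B)).
    + apply continuous_snd.
    + apply continuous_kink.
Qed.

(** The sign of [Re s - kink (Im s)] cuts the complement of the contour into two
    disjoint open sets; [x] lies in one and all large reals in the other. *)
Lemma not_in_right_component_of_lt (c A B x : R) :
  (x < c)%R -> ~ in_right_component (kinked c A B) (RtoC x).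
Proof.
  intros Hx [X HX].
  destruct (HX (Rmax X (c + 1))) as [S [HS [Hoff [Sx Sy]]]]; [apply Rmax_l|].
  refine (HS (fun s => Re s - kink c A B (Im s) < 0)%R
             (fun s => 0 < Re s - kink c A B (Im s))%R
             (open_kink_side c A B _ (open_lt 0))
             (open_kink_side c A B _ (open_gt 0)) _ _ _).
  - intros s Hs; pose proof (Hoff s Hs) as Hn.
    unfold off_curve in Hn; rewrite on_curve_kinked in Hn; lra.
  - intros s _; lra.
  - split; [exists (RtoC x)|exists (RtoC (Rmax X (c + 1)))];
      (split; [assumption|]); simpl; rewrite kink_pos by lra.
    + lra.
    + pose proof (Rmax_r X (c + 1)); lra.
Qed.

(** The sign conditions say that the first ray runs downwards and the second one
    upwards. *)
Lemma is_contour_kinked (c thm thp : R) (Lp Lm : C -> Prop) :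
  (sin thm < 0)%R -> (0 < sin thp)%R ->
  (forall s, Lp s -> Im s = 0%R /\ (c < Re s)%R) ->
  (forall s, Lm s -> Im s = 0%R /\ (Re s < c)%R) ->
  is_contour thm thp Lp Lm (kinked c (cot thm) (cot thp)).
Proof.
  intros Hm Hp HLp HLm; split.
  - intros t u E; now injection E.
  - apply piecewise_smooth_kinked.
  - split; apply kinked_proper; tauto.
  - exists (RtoC c), (RtoC c), 0%R; split.
    + intros s _.
      rewrite on_curve_kinked, on_ray_down, on_ray_up by assumption.
      destruct (Rle_or_lt 0 (Im s)).
      * rewrite kink_pos by assumption.
        split; [tauto|intros [[H1 H2]|H1]; [|tauto]].
        rewrite H2; replace (Im s) with 0%R by lra; ring.
      * rewrite kink_neg by lra; split; [intros; left; split; [lra|assumption]|].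
        intros [H1|H1]; lra.
    + exists 0%R; split; intros t Ht.
      * apply on_ray_down; [assumption|]; simpl.
        split; [lra|apply kink_neg; lra].
      * apply on_ray_up; [assumption|]; simpl.
        split; [lra|apply kink_pos; lra].
  - intros s Hs H; apply on_curve_kinked in H.
    assert (Hs' : Im s = 0%R /\ Re s <> c).
    { destruct Hs as [Hs|Hs]; [apply HLp in Hs|apply HLm in Hs];
        destruct Hs; (split; [assumption|intros E; lra]). }
    destruct Hs' as [E Hne]; rewrite E, kink_pos in H by lra; lra.
  - intros s Hs; apply HLp in Hs; destruct s as [x y], Hs as [E Hx]; simpl in *.
    rewrite E; now apply in_right_component_of_gt.
  - intros s Hs; apply HLm in Hs; destruct s as [x y], Hs as [E Hx]; simpl in *.
    rewrite E; now apply not_in_right_component_of_lt.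
Qed.

(** Any real [c] strictly between [lambda_sharp] and [lambda_flat] will do,
    because [lambda_flat] bounds the first pole family from below and
    [lambda_sharp], with [l = k = 1], the second from above. *)
Lemma pole_separation (tau : R) (m n p q : nat) (a b : nat -> C) :
  (0 < tau)%R ->
  Rbar_lt (lambda_sharp tau m q b) (lambda_flat n p a) ->
  (forall j, (1 <= j <= p)%nat -> Im (a j) = 0%R) ->
  (forall j, (1 <= j <= q)%nat -> Im (b j) = 0%R) ->
  exists c : R,
    (forall s, Lambda_plus tau n p a s -> Im s = 0%R /\ (c < Re s)%R) /\
    (forall s, Lambda_minus tau m q b s -> Im s = 0%R /\ (Re s < c)%R).
Proof.
  intros Htau Hlt Ha Hb; unfold lambda_sharp, lambda_flat in Hlt.
  match type of Hlt with
  | Rbar_lt (Lub_Rbar ?P) (Glb_Rbar ?Q) =>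
      pose proof (proj1 (Lub_Rbar_correct P)) as HP;
      pose proof (proj1 (Glb_Rbar_correct Q)) as HQ;
      set (l := Lub_Rbar P) in *; set (u := Glb_Rbar Q) in *
  end.
  assert (Hc : exists c : R, Rbar_lt l c /\ Rbar_lt c u).
  { destruct l as [l| |], u as [u| |]; simpl in *; try tauto.
    - exists ((l + u) / 2)%R; lra.
    - exists (l + 1)%R; lra.
    - exists (u - 1)%R; lra.
    - now exists 0%R. }
  destruct Hc as [c [Hl Hu]]; exists c; split.
  - intros s [j [l' [k [Hj ->]]]]; simpl; split.
    + change (snd (a j)) with (Im (a j)); rewrite Ha by lia; ring.
    + assert (H : Rbar_le u (Re (a j))) by (apply HQ; now exists j).
      pose proof (Rbar_lt_le_trans _ _ _ Hu H) as H'; simpl in H'.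
      pose proof (pos_INR k).
      pose proof (Rmult_le_pos _ _ (pos_INR l') (Rlt_le _ _ Htau)).
      unfold Re in *; lra.
  - intros s [j [l' [k [Hj [Hl' [Hk ->]]]]]]; simpl; split.
    + change (snd (b j)) with (Im (b j)); rewrite Hb by lia; ring.
    + assert (H : Rbar_le (Re (b j) - tau - 1)%R l) by (apply HP; now exists j).
      pose proof (Rbar_le_lt_trans _ _ _ H Hl) as H'; simpl in H'.
      apply le_INR in Hl', Hk; simpl in Hl', Hk.
      pose proof (Rmult_le_compat_r _ _ _ (Rlt_le _ _ Htau) Hl').
      unfold Re in *; lra.
Qed.

(** * Integrals along the kinked lines *)

Definition line_integrand (f : C -> C) (g : R -> C) (t : R) : C :=
  f (g t) * curve_deriv g t.

Definition is_line_integral (f : C -> C) (g : R -> C) (I : C) : Prop :=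
  is_RInt_gen (V := C_R_NormedModule) (line_integrand f g)
    (Rbar_locally m_infty) (Rbar_locally p_infty) I.

Lemma kinked_reflect (c A B t : R) :
  kinked c (- B) (- A) t = Cconj (kinked c A B (- t)).
Proof.
  unfold kinked, kink, Cconj; simpl; rewrite Rabs_Ropp.
  f_equal; field.
Qed.

Lemma curve_deriv_kinked_reflect (c A B t : R) :
  t <> 0%R ->
  curve_deriv (kinked c (- B) (- A)) t
  = - Cconj (curve_deriv (kinked c A B) (- t)).
Proof.
  intros Ht; rewrite !curve_deriv_kinked by lra.
  unfold Cconj, Copp; simpl.
  destruct (Rlt_dec 0 t), (Rlt_dec 0 (- t)); try lra; f_equal; ring.
Qed.

(** Conjugation exchanges the two rays up to orientation: substituting [- t] for
    [t] contributes no sign to an integral over the whole line, but one to the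
    velocity. *)
Lemma is_line_integral_reflect (f : C -> C) (c A B : R) (I : C) :
  conj_symmetric f ->
  is_line_integral f (kinked c A B) I ->
  is_line_integral f (kinked c (- B) (- A)) (- Cconj I).
Proof.
  intros Hf H.
  pose proof (is_RInt_gen_opp (V := C_R_NormedModule) _ _
    (is_RInt_gen_conj_reflect _ _ H)) as H'.
  refine (is_RInt_gen_ext_off_zero _ _ _ _ _ _ H').
  intros t Ht; unfold line_integrand.
  rewrite curve_deriv_kinked_reflect, kinked_reflect by exact Ht.
  rewrite <- (Hf (Cconj _)), Cconj_conj, Cmult_conj.
  change (- (Cconj (f (kinked c A B (- t)))
             * Cconj (curve_deriv (kinked c A B) (- t)))
          = Cconj (f (kinked c A B (- t)))
            * - Cconj (curve_deriv (kinked c A B) (- t))).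
  ring.
Qed.

(** Two contours from the same point may exchange their upper rays without
    changing the sum of the integrals: at every parameter off [0] the sum of
    the two integrands stays the same. *)
Lemma line_integral_exchange (f : C -> C) (c A B A' B' : R) (I1 I2 J1 J2 : C) :
  is_line_integral f (kinked c A B) I1 ->
  is_line_integral f (kinked c A' B') I2 ->
  is_line_integral f (kinked c A B') J1 ->
  is_line_integral f (kinked c A' B) J2 ->
  I1 + I2 = J1 + J2.
Proof.
  intros H1 H2 H3 H4.
  pose proof (is_RInt_gen_plus (V := C_R_NormedModule) _ _ _ _ H1 H2) as H12.
  pose proof (is_RInt_gen_plus (V := C_R_NormedModule) _ _ _ _ H3 H4) as H34.
  refine (is_RInt_gen_unique_line _ _ _ H12
            (is_RInt_gen_ext_off_zero _ _ _ _ _ _ H34)).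
  intros t Ht; unfold line_integrand, kinked at 1 3 5 7.
  destruct (Rlt_dec 0 t) as [Hp|Hp].
  - rewrite !curve_deriv_kinked_pos, !kink_pos by lra.
    apply (plus_comm (G := C_R_NormedModule)).
  - rewrite !curve_deriv_kinked_neg, !kink_neg by lra; reflexivity.
Qed.

Definition inv_2PiI : C := RtoC 1 / (RtoC 2 * RtoC PI * Ci).

Lemma inv_2PiI_conj : Cconj inv_2PiI = - inv_2PiI.
Proof.
  unfold inv_2PiI; rewrite Cdiv_conj_total, !Cmult_conj, !Cconj_RtoC.
  assert (HPi : RtoC PI <> RtoC 0).
  { intros E; injection E; apply PI_neq0. }
  assert (Hi : Ci <> RtoC 0) by (intros E; injection E; lra).
  replace (Cconj Ci) with (- Ci)
    by (unfold Cconj, Ci, Copp; simpl; f_equal; ring).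
  field; now split.
Qed.

Lemma is_K_kinked (f : C -> C) (Lp Lm : C -> Prop) (thm thp : R -> R)
    (c z eps : R) (K : C) :
  is_K f Lp Lm thm thp z K ->
  (0 < eps < PI / 4)%R ->
  (sin (thm eps) < 0)%R -> (0 < sin (thp eps))%R ->
  (forall s, Lp s -> Im s = 0%R /\ (c < Re s)%R) ->
  (forall s, Lm s -> Im s = 0%R /\ (Re s < c)%R) ->
  exists I,
    is_line_integral (fun s => f s * Rcpow z (- s))
      (kinked c (cot (thm eps)) (cot (thp eps))) I /\
    K = inv_2PiI * I.
Proof.
  intros [_ HK] Heps Hm Hp HLp HLm.
  destruct (HK eps (kinked c (cot (thm eps)) (cot (thp eps))))
    as [I [[_ HI] E]].
  - split; [exact Heps|]; now apply is_contour_kinked.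
  - now exists I.
Qed.

Lemma cot_opp (x : R) : cot (- x) = (- cot x)%R.
Proof.
  unfold cot; rewrite cos_neg, sin_neg; unfold Rdiv.
  rewrite Rinv_opp; ring.
Qed.

Lemma cot_PI_minus (x : R) : cot (PI - x) = (- cot x)%R.
Proof.
  unfold cot; rewrite sin_PI_x, (Rtrigo_facts.cos_pi_minus x); unfold Rdiv; ring.
Qed.

(** The sign from the reversed orientation cancels against the conjugate of
    [1 / (2 PI i)]. *)
Lemma conj_of_reflected_integral (I J : C) :
  J = - Cconj I -> inv_2PiI * J = Cconj (inv_2PiI * I).
Proof. intros ->; rewrite Cmult_conj, inv_2PiI_conj; ring. Qed.

Lemma Im_eq_0_of_conj (s : C) : s = Cconj s -> Im s = 0%R.
Proof. intros E; apply (f_equal Im) in E; rewrite im_conj in E; lra. Qed.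

Definition four_values (x y w : R) : C * C * C * C :=
  (RtoC x, RtoC y, ((x + y) / 2, w)%R, ((x + y) / 2, - w)%R).

Lemma four_values_of_symmetry (Kr Kl Ku Kd : C) :
  Kr = Cconj Kr -> Kl = Cconj Kl -> Kd = Cconj Ku -> Kr + Kl = Ku + Kd ->
  Im Kr = 0%R /\
  Im Kl = 0%R /\
  Kd = Cconj Ku /\
  RtoC (Re Ku) = (Kr + Kl) / RtoC 2 /\
  (Kr, Kl, Ku, Kd) = four_values (Re Kr) (Re Kl) (Im Ku).
Proof.
  intros Cr Cl Cd Hsum; apply Im_eq_0_of_conj in Cr, Cl.
  assert (Hre : RtoC (Re Ku) = (Kr + Kl) / RtoC 2).
  { rewrite Hsum, Cd; apply re_alt. }
  repeat split; try assumption.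
  destruct Kr as [r r'], Kl as [l l'], Ku as [u u'].
  apply (f_equal Re) in Hsum; simpl in Cr, Cl; subst Kd r' l'.
  unfold four_values, Cconj; simpl in *.
  replace ((r + l) / 2)%R with u by lra; reflexivity.
Qed.

Theorem corollary6p3 :
  exists F : R -> R -> R -> C * C * C * C,
  forall (tau c1 c2 : R) (alpha : C) (m n p q : nat) (a b : nat -> C) (z : R),
    (0 < tau)%R ->
    barnes_constants tau c1 c2 ->
    (m <= q)%nat -> (n <= p)%nat ->
    (bigN m n p q < 0)%Z ->
    Rbar_lt (lambda_sharp tau m q b) (lambda_flat n p a) ->
    (forall j : nat, (1 <= j <= p)%nat -> Im (a j) = 0%R) ->
    (forall j : nat, (1 <= j <= q)%nat -> Im (b j) = 0%R) ->
    Im alpha = 0%R ->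
    (0 < z)%R ->
    let f := phi (barnes_G tau c1 c2) tau alpha m n p q a b in
    let Lp := Lambda_plus tau n p a in
    let Lm := Lambda_minus tau m q b in
    (forall s : C, Cconj (f (Cconj s)) = f s) /\
    (forall Kr Kl Ku Kd : C,
       is_K_right f Lp Lm z Kr ->
       is_K_left f Lp Lm z Kl ->
       is_K_up f Lp Lm z Ku ->
       is_K_down f Lp Lm z Kd ->
       Im Kr = 0%R /\
       Im Kl = 0%R /\
       Kd = Cconj Ku /\
       RtoC (Re Ku) = (Kr + Kl) / RtoC 2 /\
       (Kr, Kl, Ku, Kd) = F (Re Kr) (Re Kl) (Im Ku)).
Proof.
  exists four_values.
  intros tau c1 c2 alpha m n p q a b z Htau _ Hm Hn _ Hlt Ha Hb Hal _ f Lp Lm.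
  assert (Hf : conj_symmetric f) by now apply phi_conj_symmetric.
  split; [exact Hf|].
  intros Kr Kl Ku Kd HKr HKl HKu HKd.
  destruct (pole_separation tau m n p q a b Htau Hlt Ha Hb) as [c [HLp HLm]].
  fold Lp in HLp; fold Lm in HLm.
  (* Any value in [(0, PI / 4)], the same for all four contours. *)
  set (eps := (PI / 8)%R).
  pose proof PI_RGT_0 as HPI.
  assert (Heps : (0 < eps < PI / 4)%R) by (unfold eps; lra).
  assert (S1 : (0 < sin eps)%R) by (apply sin_gt_0; lra).
  assert (S2 : (0 < sin (PI - eps))%R) by (rewrite sin_PI_x; exact S1).
  assert (S3 : (sin (- eps) < 0)%R) by (rewrite sin_neg; lra).
  assert (S4 : (sin (- PI + eps) < 0)%R).
  { replace (- PI + eps)%R with (- (PI - eps))%R by ring.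
    rewrite sin_neg; lra. }
  assert (C4 : cot (- PI + eps) = cot eps).
  { replace (- PI + eps)%R with (- (PI - eps))%R by ring.
    rewrite cot_opp, cot_PI_minus; ring. }
  destruct (is_K_kinked _ _ _ _ _ c z eps _ HKr Heps S3 S1 HLp HLm) as [Ir [Hr Er]].
  destruct (is_K_kinked _ _ _ _ _ c z eps _ HKl Heps S4 S2 HLp HLm) as [Il [Hl El]].
  destruct (is_K_kinked _ _ _ _ _ c z eps _ HKu Heps S3 S2 HLp HLm) as [Iu [Hu Eu]].
  destruct (is_K_kinked _ _ _ _ _ c z eps _ HKd Heps S4 S1 HLp HLm) as [Id [Hd Ed]].
  cbv beta in Hr, Hl, Hu, Hd.
  rewrite cot_opp in Hr.
  rewrite C4, cot_PI_minus in Hl.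
  rewrite cot_opp, cot_PI_minus in Hu.
  rewrite C4 in Hd.
  set (k := cot eps) in *.
  set (h := fun s => f s * Rcpow z (- s)) in *.
  assert (Hh : conj_symmetric h) by now apply Mellin_conj_symmetric.
  pose proof (is_line_integral_reflect h c _ _ _ Hh Hr) as Hr'.
  pose proof (is_line_integral_reflect h c _ _ _ Hh Hl) as Hl'.
  pose proof (is_line_integral_reflect h c _ _ _ Hh Hu) as Hu'.
  rewrite Ropp_involutive in Hr', Hl', Hu'.
  pose proof (line_integral_exchange h c _ _ _ _ _ _ _ _ Hr Hl Hu Hd) as Hsum.
  apply four_values_of_symmetry.
  - rewrite Er; apply conj_of_reflected_integral.
    exact (is_RInt_gen_unique_line _ _ _ Hr Hr').
  - rewrite El; apply conj_of_reflected_integral.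
    exact (is_RInt_gen_unique_line _ _ _ Hl Hl').
  - rewrite Ed, Eu; apply conj_of_reflected_integral.
    exact (is_RInt_gen_unique_line _ _ _ Hd Hu').
  - rewrite Er, El, Eu, Ed, <- !Cmult_plus_distr_l, Hsum; reflexivity.
Qed.
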